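(* Let $n,p\ge 1$, let $X\in\mathbb{R}^{n\times p}$ be a deterministic matrix with columns $X^{(1)},\dots,X^{(p)}$ normalized so that $(X^TX)_{jj}=n$ for all $1\le j\le p$, let $\sigma>0$, and let $\epsilon$ be a standard normal random vector in $\mathbb{R}^n$ (mean zero, identity covariance). Let $K_\kappa$ and $F$ be the correlation factors of $X$ defined in the context. Then the following hold. (1) For every $\kappa\in(0,1]$ and every $$\lambda\ \ge\ \lambda_\kappa:=K_\kappa\, 2\sigma\sqrt{2n\log(2p/\kappa)},$$ the event $$\mathcal{T}:=\left\{\sup_{\beta\in\mathbb{R}^p,\ \beta\neq 0}\frac{2\sigma|\epsilon^TX\beta|}{\|\beta\|_1}\le\lambda\right\}$$ satisfies $\mathbb{P}(\mathcal{T})\ge 1-\kappa$. (2) For every $M\ge 0$, $$\mathbb{E}\left[\sup_{\beta\in\mathbb{R}^p,\ \|\beta\|_1\le M}\sigma|\epsilon^TX\beta|\right]\ \le\ F\,\sigma\sqrt{\frac{8n\log(1+p)}{3}}\;M.$$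
   Context: Notation: $S^{n-1}$ is the Euclidean unit sphere of $\mathbb{R}^n$, so $\sqrt n S^{n-1}$ is the sphere of radius $\sqrt n$. For vectors $x^{(1)},\dots,x^{(l)}\in\mathbb{R}^n$, $\operatorname{sconv}\{x^{(1)},\dots,x^{(l)}\}$ denotes their symmetric convex hull, i.e. the set of all $\sum_{j=1}^l c_jx^{(j)}$ with $c_j\in\mathbb{R}$ and $\sum_{j=1}^l|c_j|\le 1$. Correlation function of $X$: for $x\in[0,\infty)$, $$K(x):=\min\Big\{l\in\{1,2,\dots\}:\ \exists\, x^{(1)},\dots,x^{(l)}\in\sqrt n S^{n-1}\ \text{such that}\ X^{(m)}\in(1+x)\operatorname{sconv}\{x^{(1)},\dots,x^{(l)}\}\ \text{for all } 1\le m\le p\Big\}.$$ Correlation factors of $X$: for $\kappa\in(0,1]$, $$K_\kappa:=\inf_{x\in[0,\infty)}(1+x)\sqrt{\frac{\log(2K(x)/\kappa)}{\log(2p/\kappa)}},\qquad F:=\inf_{x\in[0,\infty)}(1+x)\sqrt{\frac{\log(1+K(x))}{\log(1+p)}}.$$ *)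

(* Defs.v *)
From HB Require Import structures.
From mathcomp Require Import all_boot all_order all_algebra.
From mathcomp Require Import all_classical all_reals all_analysis.

Set Implicit Arguments.
Unset Strict Implicit.
Unset Printing Implicit Defensive.
Import Order.TTheory GRing.Theory Num.Theory.
Import numFieldNormedType.Exports.
Local Open Scope classical_set_scope.
Local Open Scope ring_scope.

(* The norm that the library puts on matrices is the sup norm, so the
   Euclidean and l1 norms are defined here. *)
Definition l2norm (R : realType) (n : nat) (v : 'cV[R]_n) : R :=
  Num.sqrt (\sum_i v i ord0 ^+ 2).

Definition l1norm (R : realType) (n : nat) (v : 'cV[R]_n) : R :=
  \sum_i `|v i ord0|.

Definition euclidean_sphere (R : realType) (n : nat) (r : R) : set 'cV[R]_n :=
  [set v | l2norm v = r].

Definition sconv (R : realType) (n l : nat) (y : 'I_l -> 'cV[R]_n) :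
    set 'cV[R]_n :=
  [set v | exists c : 'I_l -> R,
     \sum_j `|c j| <= 1 /\ v = \sum_j c j *: y j].

Definition corr_admissible (R : realType) (n p : nat) (X : 'M[R]_(n, p))
    (x : R) : set nat :=
  [set l | (0 < l)%N /\
     exists y : 'I_l -> 'cV[R]_n,
       (forall j, euclidean_sphere (Num.sqrt n%:R) (y j)) /\
       (forall m : 'I_p, [set (1 + x) *: v | v in sconv y] (col m X))].

(* The value 0 is returned only when no [l] is admissible; [corr_funP] below
   shows that this does not occur for a normalized matrix with p >= 1. *)
Definition corr_fun (R : realType) (n p : nat) (X : 'M[R]_(n, p)) (x : R) :
    nat :=
  xget 0%N [set l | corr_admissible X x l /\
              forall k, corr_admissible X x k -> (l <= k)%N].

Definition corr_factor_kappa (R : realType) (n p : nat) (X : 'M[R]_(n, p))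
    (kappa : R) : R :=
  inf [set (1 + x) * Num.sqrt (ln (2 * (corr_fun X x)%:R / kappa)
                               / ln (2 * p%:R / kappa)) | x in `[0, +oo[].

Definition corr_factor (R : realType) (n p : nat) (X : 'M[R]_(n, p)) : R :=
  inf [set (1 + x) * Num.sqrt (ln (1 + (corr_fun X x)%:R)
                               / ln (1 + p%:R)) | x in `[0, +oo[].

Definition mutually_independent (R : realType) (d : measure_display)
    (T : measurableType d) (P : probability T R) (n : nat)
    (Y : 'I_n -> {RV P >-> R}) : Prop :=
  forall (A : {set 'I_n}) (B : 'I_n -> set R),
    (forall i, measurable (B i)) ->
    P (\bigcap_(i in [set` A]) (Y i @^-1` B i)) =
    (\prod_(i in A) P (Y i @^-1` B i))%E.

Definition standard_normal_vector (R : realType) (d : measure_display)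
    (T : measurableType d) (P : probability T R) (n : nat)
    (eps : 'I_n -> {RV P >-> R}) : Prop :=
  mutually_independent eps /\
  forall (i : 'I_n) (B : set R), measurable B ->
    distribution P (eps i) B = normal_prob 0 1 B.

Definition noise_vector (R : realType) (d : measure_display)
    (T : measurableType d) (P : probability T R) (n : nat)
    (eps : 'I_n -> {RV P >-> R}) (w : T) : 'cV[R]_n :=
  \col_i eps i w.

Lemma corr_funP (R : realType) (n p : nat) (X : 'M[R]_(n, p)) (x : R) :
  (0 < p)%N -> (forall j, (X^T *m X) j j = n%:R) -> 0 <= x ->
  corr_admissible X x (corr_fun X x) /\
  forall k, corr_admissible X x k -> (corr_fun X x <= k)%N.
Proof.
move=> p0 hX x0; rewrite /corr_fun.
case: xgetP => [l _ //|noL]; exfalso.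
have adm_p : corr_admissible X x p.
  split=> //; exists (fun j => col j X); split=> [j|m].
    rewrite /euclidean_sphere /= /l2norm -(hX j) mxE; congr (Num.sqrt _).
    by apply: eq_bigr => i _; rewrite !mxE expr2.
  have x1 : 0 < 1 + x by apply: ltr_pwDl.
  exists ((1 + x)^-1 *: col m X); last by rewrite scalerA mulfV ?gt_eqF ?scale1r.
  exists (fun j => if j == m then (1 + x)^-1 else 0); split.
    rewrite (bigD1 m) //= eqxx big1 => [|j /negPf ->]; last exact: normr0.
    by rewrite addr0 ger0_norm ?invr_ge0 ?(ltW x1)// invf_le1// lerDl.
  rewrite (bigD1 m) //= eqxx big1 ?addr0// => j /negPf ->.
  by rewrite scale0r.
have ex_adm : exists l, `[< corr_admissible X x l >] by exists p; apply/asboolP.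
case: (ex_minnP ex_adm) => l /asboolP adm_l min_l.
by apply: (noL l); split=> // k adm_k; apply: min_l; apply/asboolP.
Qed.

(* Main.v *)
(* X b is a combination of the columns of X with l1-weight |b|_1, and for every
   x >= 0 each column lies in (1 + x) sconv of K(x) points of the sphere of
   radius sqrt n.  So both suprema are controlled by (1 + x) times the maximum of
   K(x) centred Gaussians of variance n: a union bound over Chernoff tails gives
   (1), and exp (3/8 Z^2) having mean 2 gives (2) through Jensen's inequality for
   z |-> exp (z^2).  Optimizing over x produces the correlation factors; in (1)
   the infimum need not be attained, and right continuity of the distribution
   function closes the gap.  The law of a linear form of the noise enters only
   through its moment generating function. *)

Require Import Defs.
From HB Require Import structures.
From mathcomp Require Import all_boot all_order all_algebra.
From mathcomp Require Import all_classical all_reals all_analysis.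
From mathcomp Require Import measurable_realfun.
From mathcomp Require Import ring lra.

Set Implicit Arguments.
Unset Strict Implicit.
Unset Printing Implicit Defensive.
Import Order.TTheory GRing.Theory Num.Theory.
Import numFieldNormedType.Exports.
Local Open Scope classical_set_scope.
Local Open Scope ring_scope.

(** * Change of variables for nonnegative integrands *)

Section transfer.
Local Open Scope ereal_scope.
Context d1 d2 (T1 : measurableType d1) (T2 : measurableType d2) (R : realType).
Variables (mu : {measure set T1 -> \bar R}) (nu : {measure set T2 -> \bar R}).
Variables (D : set T1) (phi : T1 -> T2) (g : T1 -> R) (c : R).
Hypothesis mD : measurable D.
Hypothesis mphi : measurable_fun setT phi.
Hypothesis mg : measurable_fun setT g.
Hypothesis g0 : forall x, (0 <= g x)%R.
Hypothesis int_g : forall B, measurable B ->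
  \int[mu]_(x in D `&` phi @^-1` B) (g x)%:E = c%:E * nu B.

Import HBNNSimple.

Let transfer_nnsfun (h : {nnsfun T2 >-> R}) :
  \int[mu]_(x in D) ((h (phi x))%:E * (g x)%:E) = c%:E * \int[nu]_y (h y)%:E.
Proof.
have mpre r : measurable (phi @^-1` (h @^-1` [set r])).
  by rewrite -[X in measurable X]setTI; exact: mphi.
under eq_integral => x _.
  rewrite fimfunE -fsumEFin// ge0_mule_fsuml; last first.
    by move=> r; exact: nnfun_muleindic_ge0.
  over.
under [in RHS]eq_integral do rewrite fimfunE -fsumEFin//.
rewrite !ge0_integral_fsum//; last 4 first.
- by move=> r; exact/measurable_EFinP/measurable_funM.
- by move=> r x _; exact: nnfun_muleindic_ge0.
- move=> r; apply: measurable_funTS; apply/measurable_EFinP.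
  apply: measurable_funM => //; apply: measurable_funM => //.
  by rewrite [X in measurable_fun _ X](_ : _ = \1_(h @^-1` [set r]) \o phi)//; 
    exact: measurableT_comp.
- by move=> r x _; rewrite mule_ge0 ?lee_fin//; exact: nnfun_muleindic_ge0.
rewrite ge0_mule_fsumr; last first.
  by move=> r; apply: integral_ge0 => x _; exact: nnfun_muleindic_ge0.
apply: eq_fsbigr => r /[!inE] -[y _ <-].
have r0 : (0 <= h y)%R by [].
transitivity ((h y)%:E * (c%:E * nu (h @^-1` [set h y]))); last first.
  by rewrite integralZl_indic_nnsfun// integral_indic// setIT muleCA.
(* On each level set of [h] the simple function is constant, so its indicator only cuts the domain
   down to a preimage under [phi], which is the case that [int_g] covers. *)
rewrite -int_g// integral_mkcondr.
rewrite -ge0_integralZl_EFin//; last 2 first.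
- by move=> x _; rewrite patchE; case: ifP; rewrite ?lee_fin.
- apply: measurable_funTS; apply/(measurable_restrictT _ _).1 => //.
  exact/measurable_funTS/measurable_EFinP.
apply: eq_integral => x _; rewrite patchE indicE.
have -> : (x \in phi @^-1` (h @^-1` [set h y])) = (phi x \in h @^-1` [set h y]).
  by apply/idP/idP; rewrite !inE.
by case: ifP; rewrite ?mulr1 ?mulr0 ?mul0e ?mule0.
Qed.

(** The hypothesis [int_g] says that the measure with density [g] on [D] is pushed forward by [phi]
    to [c] times [nu]; simple functions and monotone convergence extend this from sets to functions.
    The general form serves three times: for a density ([phi] the identity), for the law of a
    variable ([g] equal to 1), and for splitting one factor off a product of independent ones. *)
Lemma ge0_integral_transfer (f : T2 -> \bar R) :
  measurable_fun setT f -> (forall y, 0 <= f y) ->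
  \int[mu]_(x in D) (f (phi x) * (g x)%:E) = c%:E * \int[nu]_y f y.
Proof.
move=> mf f0; pose h := nnsfun_approx measurableT mf.
transitivity (limn (fun n => \int[mu]_(x in D) ((h n (phi x))%:E * (g x)%:E))).
  rewrite -monotone_convergence//.
  - apply: eq_integral => x _; apply/esym/cvg_lim => //.
    by apply: cvgeZr => //; exact: cvg_nnsfun_approx.
  - move=> n; apply: measurable_funTS; apply/measurable_EFinP.
    by apply: measurable_funM => //; exact: measurableT_comp.
  - by move=> n x _; rewrite mule_ge0 ?lee_fin.
  - move=> x _ m n mn; apply: lee_wpmul2r; rewrite lee_fin//.
    exact/lefP/nd_nnsfun_approx.
under eq_fun do rewrite transfer_nnsfun.
apply/cvg_lim => //; apply: cvgeZl => //.
have -> : \int[nu]_y f y = \int[nu]_y limn (fun n => (h n y)%:E).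
  apply: eq_integral => y _; apply/esym/cvg_lim => //.
  exact: cvg_nnsfun_approx.
apply: cvg_monotone_convergence => //.
- by move=> n; exact/measurable_EFinP.
- by move=> n y _; rewrite lee_fin.
- by move=> y _ m n mn; rewrite lee_fin; exact/lefP/nd_nnsfun_approx.
Qed.

End transfer.

(** * Two Gaussian integrals on the line *)

Section normal_integrals.
Local Open Scope ereal_scope.
Context (R : realType).

Lemma ge0_integral_normal_prob (m s : R) (f : R -> \bar R) :
  measurable_fun setT f -> (forall x, 0 <= f x) ->
  \int[normal_prob m s]_x f x =
  \int[lebesgue_measure]_x (f x * (normal_pdf m s x)%:E).
Proof.
move=> mf f0.
rewrite (@ge0_integral_transfer _ _ _ _ R lebesgue_measure (normal_prob m s)
  setT idfun (normal_pdf m s) 1%R) ?mul1e//.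
- exact: measurable_id.
- exact: (measurable_normal_pdf m s).
- exact: (normal_pdf_ge0 m s).
- by move=> B mB; rewrite setTI mul1e.
Qed.

(** Completing the square: exp(s x) times the N(0, 1) density is exp(s^2 / 2) times the N(s, 1)
    density, which integrates to 1. *)
Lemma normal_mgf (s : R) :
  \int[normal_prob 0 1]_x (expR (s * x))%:E = (expR (s ^+ 2 / 2))%:E.
Proof.
rewrite ge0_integral_normal_prob//; last first.
  by apply/measurable_EFinP; exact: measurableT_comp.
transitivity (\int[lebesgue_measure]_x
    ((expR (s ^+ 2 / 2))%:E * (normal_pdf s 1 x)%:E)).
  apply: eq_integral => x _; rewrite -!EFinM; congr EFin.
  rewrite !normal_pdfE ?oner_neq0// mulrCA [RHS]mulrCA -!expRD.
  by congr (_ * expR _)%R; field.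
rewrite ge0_integralZl_EFin ?expR_ge0//.
- by rewrite integral_normal_pdf mule1.
- by move=> x _; rewrite lee_fin normal_pdf_ge0.
- by apply: measurableT_comp => //; exact: measurable_normal_pdf.
Qed.

(* The exponent leaves [expR (- x ^+ 2 / 8)], the density of N(0, 4) up to the
   factor 2. *)
Lemma normal_exp_sqr :
  \int[normal_prob 0 1]_x (expR (3 / 8 * x ^+ 2))%:E = 2%:E :> \bar R.
Proof.
rewrite ge0_integral_normal_prob//; last first.
  apply/measurable_EFinP; apply: measurableT_comp => //.
  by apply: measurable_funM => //; exact: measurable_funX.
transitivity (\int[lebesgue_measure]_x (2%:E * (normal_pdf 0 2 x)%:E : \bar R)).
  apply: eq_integral => x _; rewrite -!EFinM; congr EFin.
  rewrite !normal_pdfE ?oner_neq0//.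
  have -> : normal_peak 1%R = (2 * normal_peak 2)%R :> R.
    rewrite /normal_peak expr1n mul1r -mulrnAr sqrtrM ?sqr_ge0//.
    by rewrite sqrtr_sqr ger0_norm// invfM mulrA mulfV ?mul1r.
  rewrite mulrCA -!mulrA -expRD.
  by congr (_ * (_ * expR _))%R; field.
rewrite ge0_integralZl_EFin//.
- by rewrite integral_normal_pdf mule1.
- by move=> x _; rewrite lee_fin normal_pdf_ge0.
- by apply: measurableT_comp => //; exact: measurable_normal_pdf.
Qed.

End normal_integrals.

(** * Expectation of a product over independent coordinates *)

Section independence.
Local Open Scope ereal_scope.
Context (R : realType) d (T : measurableType d) (P : probability T R) (n : nat).
Variables (eps : 'I_n -> {RV P >-> R}) (f : 'I_n -> R -> R) (m : 'I_n -> R).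
Hypothesis eps_indep : mutually_independent eps.
Hypothesis mf : forall i, measurable_fun setT (f i).
Hypothesis f0 : forall i x, (0 <= f i x)%R.
Hypothesis int_f : forall i, \int[P]_w (f i (eps i w))%:E = (m i)%:E.

(* Integrating over an event of the coordinates outside [s] is what makes the
   induction on [s] go through. *)
Let integral_prod_seq (s : seq 'I_n) (C : {set 'I_n}) (B : 'I_n -> set R) :
  uniq s -> (forall i, i \in s -> i \notin C) -> (forall i, measurable (B i)) ->
  \int[P]_(w in \bigcap_(i in [set` C]) (eps i @^-1` B i))
    (\prod_(i <- s) f i (eps i w))%:E =
  (\prod_(i <- s) m i)%:E * P (\bigcap_(i in [set` C]) (eps i @^-1` B i)).
Proof.
elim: s C B => [|j s IH] C B.
  move=> _ _ mB; rewrite big_nil mul1e.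
  under eq_integral do rewrite big_nil.
  rewrite integral_cst ?mul1e//.
  apply: fin_bigcap_measurable => // i _.
  by rewrite -[X in measurable X]setTI; exact: measurable_funPT.
move=> /= /andP[js us] sC mB.
have mD : measurable (\bigcap_(i in [set` C]) (eps i @^-1` B i)).
  apply: fin_bigcap_measurable => // i _.
  by rewrite -[X in measurable X]setTI; exact: measurable_funPT.
set D := \bigcap_(i in _) _.
have jC : j \notin C by apply: sC; rewrite mem_head.
under eq_integral do rewrite big_cons EFinM.
have mprod : measurable_fun setT (fun w => \prod_(i <- s) f i (eps i w))%R.
  apply: measurable_prod => i _.
  exact: measurableT_comp.
have PD : P D \is a fin_num by exact: fin_num_measure.
(* The factor at [j] is the function transferred and the product over [s] is the density. The
   identity on sets that this requires is the induction hypothesis for the event enlarged by the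
   coordinate [j]. *)
rewrite (@ge0_integral_transfer _ _ _ _ R P (distribution P (eps j)) D (eps j)
  (fun w => \prod_(i <- s) f i (eps i w))%R (\prod_(i <- s) m i * fine (P D))%R
  mD _ mprod _ _ (fun x => (f j x)%:E))//.
- rewrite ge0_integral_distribution//; last 2 first.
  + exact/measurable_EFinP.
  + by move=> y; rewrite lee_fin.
  by rewrite int_f big_cons !EFinM fineK// muleAC [X in X * _ = _]muleC.
- by move=> w; apply: prodr_ge0.
- move=> A mA.
  (* Since [j] lies outside [C], changing the set at [j] leaves [D] as it is, and one family of sets
     describes both [D] and its intersection with the event at [j]. *)
  pose B' i := if i == j then A else B i.
  have mB' i : measurable (B' i) by rewrite /B'; case: ifP.
  have DE : D = \bigcap_(i in [set` C]) (eps i @^-1` B' i).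
    apply: eq_bigcapr => i /= iC; rewrite /B'; case: eqP => // ij.
    by move: iC; rewrite ij (negbTE jC).
  have DAE : D `&` eps j @^-1` A =
      \bigcap_(i in [set` j |: C]) (eps i @^-1` B' i).
    rewrite DE; apply/seteqP; split => [w [Dw Aw] i|w Dw].
      by rewrite /= !inE => /orP[/eqP ->|]; [rewrite /B' eqxx|exact: Dw].
    split; first by move=> i iC; apply: Dw; rewrite /= !inE (iC : is_true _)
      orbT.
    by have := Dw j; rewrite /B' eqxx; apply; rewrite /= !inE eqxx.
  rewrite DAE IH//; last first.
    move=> i si; rewrite !inE negb_or sC ?inE ?si ?orbT// andbT.
    by apply: contraNneq js => <-.
  (* Independence is used in both directions: to factor over [j |: C], then to reassemble the
     factors over [C] into P(D). *)
  rewrite eps_indep// big_setU1//= -eps_indep// -DE /B' eqxx.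
  by rewrite EFinM fineK// -muleA [P D * _]muleC.
- exact/measurable_EFinP.
- by move=> y; rewrite lee_fin.
Qed.

Lemma integral_prod_independent :
  \int[P]_w (\prod_i f i (eps i w))%:E = (\prod_i m i)%:E.
Proof.
have := @integral_prod_seq (index_enum 'I_n) finset.set0 (fun=> setT)
  (index_enum_uniq _).
rewrite (_ : \bigcap_(i in _) _ = setT); last first.
  by apply/seteqP; split => // w _ i.
rewrite probability_setT mule1; apply => //.
by move=> i _; rewrite inE.
Qed.

End independence.

(** * Linear forms of the noise: moment generating function and tails *)

Section noise.
Context (R : realType) d (T : measurableType d) (P : probability T R) (n : nat).
Variable eps : 'I_n -> {RV P >-> R}.
Hypothesis eps_normal : standard_normal_vector eps.

Definition noise_form (v : 'cV[R]_n) (w : T) : R :=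
  ((noise_vector eps w)^T *m v) ord0 ord0.

Lemma noise_formE v w : noise_form v w = \sum_i eps i w * v i ord0.
Proof.
by rewrite /noise_form mxE; apply: eq_bigr => i _; rewrite !mxE.
Qed.

Lemma measurable_noise_form v : measurable_fun setT (noise_form v).
Proof.
rewrite (_ : noise_form v = fun w => \sum_i eps i w * v i ord0); last first.
  by apply/funext => w; exact: noise_formE.
by apply: measurable_sum => i; exact: measurable_funM.
Qed.

Lemma sqr_l2norm (v : 'cV[R]_n) : l2norm v ^+ 2 = \sum_i v i ord0 ^+ 2.
Proof. by rewrite sqr_sqrtr// sumr_ge0// => i _; exact: sqr_ge0. Qed.

(** The exponential of the form is a product over independent coordinates, and the exponents (s
    v_i)^2 / 2 of the factors add up to a multiple of the squared Euclidean norm. *)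
Lemma noise_mgf v s : (\int[P]_w (expR (s * noise_form v w))%:E =
  (expR (s ^+ 2 * l2norm v ^+ 2 / 2))%:E)%E.
Proof.
have [indep normal_eps] := eps_normal.
transitivity (\int[P]_w (\prod_i expR (s * v i ord0 * eps i w))%:E)%E.
  apply: eq_integral => w _; rewrite -expR_sum; congr (expR _)%:E.
  by rewrite noise_formE mulr_sumr; apply: eq_bigr => i _; rewrite mulrAC mulrA.
rewrite (integral_prod_independent (f := fun i x => expR (s * v i ord0 * x))
  (m := fun i => expR ((s * v i ord0) ^+ 2 / 2)))//.
- rewrite -expR_sum sqr_l2norm mulr_sumr mulr_suml; congr (expR _)%:E.
  by apply: eq_bigr => i _; rewrite exprMn.
- by move=> i; apply: measurableT_comp => //; exact: measurable_funM.
- move=> i; rewrite -normal_mgf.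
  (* [normal_prob] is a measure on [measurableTypeR R], whose measurable sets
     are convertible, but not syntactically equal, to those of [R]. *)
  refine (etrans _ (etrans (@ge0_integral_transfer _ _ T _ R P (normal_prob 0 1)
    setT (eps i) (fun=> 1) 1 measurableT _ _ _ _
    (fun x => (expR (s * v i ord0 * x))%:E) _ _) _)) => //=.
  + by apply: eq_integral => w _; rewrite mule1.
  + by move=> mT B mB; exact: (@measurable_funPT _ _ _ _ (eps i) mT B mB).
  + move=> B mB; rewrite setTI integral_cst ?mul1e//; first exact: normal_eps.
    by rewrite -[X in measurable X]setTI; exact: measurable_funPT.
  + have mexp : measurable_fun setT (fun x : R => (expR (s * v i ord0 * x))%:E).
      apply/measurable_EFinP; exact: measurableT_comp.
    by move=> mT B mB; exact: (mexp mT B mB).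
  + by rewrite mul1e.
Qed.

Let chernoff_noise v t : 0 < t -> l2norm v != 0 ->
  (P [set w | (t <= noise_form v w)%R] <=
   (expR (- (t ^+ 2 / (2 * l2norm v ^+ 2))))%:E)%E.
Proof.
move=> t0 v0; have v2 : 0 < l2norm v ^+ 2 by rewrite exprn_even_gt0.
pose Z : {RV P >-> R} :=
  HB.pack (noise_form v)
    (isMeasurableFun.Build _ _ _ _ _ (measurable_noise_form v)).
(* The parameter minimizes s^2 |v|^2 / 2 - s t over s. *)
have := @chernoff _ _ _ P Z (t / l2norm v ^+ 2) t (divr_gt0 t0 v2).
move/le_trans; apply.
rewrite /mmt_gen_fun unlock.
rewrite [X in (X * _)%E](_ : _ =
    (expR ((t / l2norm v ^+ 2) ^+ 2 * l2norm v ^+ 2 / 2))%:E)%E; last first.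
  rewrite -(noise_mgf v (t / l2norm v ^+ 2)).
  apply: eq_integral => w _ /=; congr (expR _)%:E; exact: mulrC.
rewrite -EFinM -expRD lee_fin ler_expR le_eqVlt; apply/orP; left; apply/eqP.
by field.
Qed.

Lemma noise_form_opp v w : noise_form (- v) w = - noise_form v w.
Proof. by rewrite /noise_form mulmxN mxE. Qed.

Lemma l2norm_opp (v : 'cV[R]_n) : l2norm (- v) = l2norm v.
Proof.
by congr Num.sqrt; apply: eq_bigr => i _; rewrite mxE sqrrN.
Qed.

Lemma noise_form_tail v t : 0 < t -> l2norm v != 0 ->
  (P [set w | (t <= `|noise_form v w|)%R] <=
   (2 * expR (- (t ^+ 2 / (2 * l2norm v ^+ 2))))%:E)%E.
Proof.
move=> t0 v0.
have mge u : measurable [set w | t <= noise_form u w].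
  rewrite -[X in measurable X]setTI.
  have := measurable_noise_form u measurableT (measurable_itv `[t, +oo[).
  by congr measurable; apply/seteqP; split => w /=; rewrite in_itv/= andbT.
have -> : [set w | t <= `|noise_form v w|] =
    [set w | t <= noise_form v w] `|` [set w | t <= noise_form (- v) w].
  apply/seteqP; split => w /=; rewrite noise_form_opp lerNr.
    by rewrite ler_normr lerNr => /orP.
  by rewrite ler_normr lerNr => /orP.
apply: (le_trans (measureU2 P (mge _) (mge _))).
rewrite mulr2n mulrDl mul1r EFinD leeD ?chernoff_noise//.
by rewrite -(l2norm_opp v) chernoff_noise ?l2norm_opp.
Qed.

(* [exp (3/8 z^2)] is the normal mgf at [sqrt (3/4) z]; exchanging the two
   integrals leaves the mgf of the noise. *)
Lemma noise_form_exp_sqr v : l2norm v != 0 ->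
  (\int[P]_w (expR (3 / 8 * (noise_form v w / l2norm v) ^+ 2))%:E = 2%:E)%E.
Proof.
move=> v0; pose c : R := Num.sqrt (3 / 4) / l2norm v.
have c2 : c ^+ 2 = 3 / 4 / l2norm v ^+ 2.
  by rewrite /c exprMn sqr_sqrtr// exprVn.
pose F (wg : T * R) := (expR (c * noise_form v wg.1 * wg.2))%:E.
transitivity (\int[P]_w \int[normal_prob 0 1]_g F (w, g))%E.
  apply: eq_integral => w _; rewrite /F/= normal_mgf [(c * _) ^+ 2]exprMn c2.
  by congr (expR _)%:E; field.
rewrite fubini_tonelli//; last 2 first.
- apply/measurable_EFinP; apply: measurableT_comp => //.
  apply: measurable_funM => //; apply: measurable_funM => //.
  by apply: measurableT_comp => //; exact: measurable_noise_form.
- by move=> x; rewrite lee_fin expR_ge0.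
(* After the exchange the inner integral is the noise mgf at [c * g], that is exp(3/8 g^2), whose
   mean under N(0, 1) is 2. *)
rewrite -normal_exp_sqr; apply: eq_integral => g _.
rewrite /F/=; under eq_integral do rewrite mulrAC.
by rewrite noise_mgf [(c * _) ^+ 2]exprMn c2; congr (expR _)%:E; field.
Qed.

End noise.

(** * Maximum of finitely many noise forms: tail and expectation *)

Section noise_max.
Context (R : realType) d (T : measurableType d) (P : probability T R) (n : nat).
Variable eps : 'I_n -> {RV P >-> R}.
Hypothesis eps_normal : standard_normal_vector eps.

(** The starting value 0 lies below every absolute value, so it never alters the maximum of a
    nonempty family. *)
Definition noise_max l (y : 'I_l -> 'cV[R]_n) (w : T) : R :=
  \big[Num.max/0]_(j < l) `|noise_form eps (y j) w|.

Lemma noise_max_ge0 l (y : 'I_l -> 'cV[R]_n) w : 0 <= noise_max y w.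
Proof.
rewrite /noise_max; elim/big_rec: _ => // i x _ _.
by rewrite le_max normr_ge0.
Qed.

Lemma measurable_noise_max l (y : 'I_l -> 'cV[R]_n) :
  measurable_fun setT (noise_max y).
Proof.
rewrite /noise_max; elim: (index_enum 'I_l) => [|j s IH].
  by under eq_fun do rewrite big_nil; exact: measurable_cst.
under eq_fun do rewrite big_cons.
apply: measurable_maxr => //; apply: measurableT_comp => //.
exact: measurable_noise_form.
Qed.

(** A union bound over the forms. The event is strict so that its complement is the closed sublevel
    set wanted later. *)
Lemma noise_max_tail l (y : 'I_l -> 'cV[R]_n) t r : 0 < t -> r != 0 ->
  (forall j, l2norm (y j) = r) ->
  (P [set w | (t < noise_max y w)%R] <=
   (l%:R * (2 * expR (- (t ^+ 2 / (2 * r ^+ 2)))))%:E)%E.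
Proof.
move=> t0 r0 yr; pose A j := [set w | t <= `|noise_form eps (y j) w|].
have mA j : measurable (A j).
  rewrite -[X in measurable X]setTI.
  have mN : measurable_fun setT (fun w => `|noise_form eps (y j) w|).
    by apply: measurableT_comp => //; exact: measurable_noise_form.
  have := mN measurableT _ (measurable_itv `[t, +oo[).
  by congr measurable; apply/seteqP; split => w /=; rewrite in_itv/= andbT.
have [mU PU] : measurable (\big[setU/set0]_j A j) /\
    (P (\big[setU/set0]_j A j) <= \sum_j P (A j))%E.
  apply: (big_ind2 (fun U s => measurable U /\ P U <= s)%E) => //.
  - by rewrite measure0.
  - move=> U s V u [mU Us] [mV Vu]; split; first exact: measurableU.
    by apply: (le_trans (measureU2 P mU mV)); exact: leeD.
apply: (@le_trans _ _ (P (\big[setU/set0]_j A j))).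
  apply: le_measure; rewrite ?inE//.
    rewrite -[X in measurable X]setTI.
    have := measurable_noise_max y measurableT (measurable_itv `]t, +oo[).
    by congr measurable; apply/seteqP; split => w /=; rewrite in_itv/= andbT.
  move=> w /= tw; apply: contrapT => notU; move: tw; apply/negP; rewrite -leNgt.
  apply: bigmax_le; first exact: ltW.
  move=> j _; rewrite leNgt; apply/negP => /ltW tj.
  by apply: notU; rewrite (bigD1 j)//=; left.
apply: (le_trans PU).
apply: (@le_trans _ _ (\sum_(j < l)
    (2 * expR (- (t ^+ 2 / (2 * r ^+ 2))))%:E)%E).
  by apply: lee_sum => j _; rewrite -(yr j) noise_form_tail// yr.
by rewrite sumEFin sumr_const card_ord (mulr_natl _ l).
Qed.

(* The tangent at [a] to the convex function [z |-> exp (z ^ 2)]. *)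
Let tangent (a z : R) :
  2 * a * expR (a ^+ 2) * z <=
  2 * a * expR (a ^+ 2) * a + expR (z ^+ 2) - expR (a ^+ 2).
Proof.
have -> : z ^+ 2 = a ^+ 2 + (z ^+ 2 - a ^+ 2) by ring.
rewrite expRD; set b := z ^+ 2 - a ^+ 2.
have eb : expR (a ^+ 2) * (1 + b) <= expR (a ^+ 2) * expR b.
  by rewrite ler_wpM2l ?expR_ge0// expR_ge1Dx.
have sqz : 0 <= expR (a ^+ 2) * (z - a) ^+ 2.
  by rewrite mulr_ge0 ?expR_ge0 ?sqr_ge0.
rewrite -subr_ge0; apply: (le_trans (addr_ge0 sqz _)).
  by rewrite -subr_ge0 in eb; exact: eb.
by rewrite le_eqVlt; apply/orP; left; apply/eqP; rewrite /b; ring.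
Qed.

(** Jensen's inequality in pointwise form: the tangent at [a] is integrated, where exp(a^2) = 1 + l.
    At the largest form, exp(z^2) is at most the sum of all [e] minus l - 1, of mean 2 l - (l - 1) =
    1 + l; the two exponentials balance and the mean of the maximum is at most [c * a]. *)
Lemma noise_max_expectation l (y : 'I_l -> 'cV[R]_n) r : (0 < l)%N -> 0 < r ->
  (forall j, l2norm (y j) = r) ->
  (\int[P]_w (noise_max y w)%:E <=
   (r * Num.sqrt (8 / 3 * ln (1 + l%:R)))%:E)%E.
Proof.
move=> l0 r0 yr.
have l1 : 1 < 1 + l%:R :> R by rewrite ltrDl ltr0n.
pose a : R := Num.sqrt (ln (1 + l%:R)).
have a2 : a ^+ 2 = ln (1 + l%:R) by rewrite sqr_sqrtr// ltW// ln_gt0.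
have a0 : 0 < a by rewrite sqrtr_gt0 ln_gt0.
have ea : expR (a ^+ 2) = 1 + l%:R by rewrite a2 lnK// posrE (lt_trans ltr01).
(* The scale for which (|Z| / c)^2 = 3/8 (Z / r)^2, so that its exponential has mean 2. *)
pose c : R := r * Num.sqrt (8 / 3).
have c0 : 0 < c by rewrite mulr_gt0// sqrtr_gt0.
pose k := 2 * a * (1 + l%:R).
have k0 : 0 < k by rewrite /k !mulr_gt0// (lt_trans ltr01).
pose e j w := expR (3 / 8 * (noise_form eps (y j) w / r) ^+ 2).
have eE j w : e j w = expR ((`|noise_form eps (y j) w| / c) ^+ 2).
  rewrite /e /c !exprMn -normrX ger0_norm ?sqr_ge0// !exprVn exprMn sqr_sqrtr//.
  by congr expR; field; rewrite gt_eqF.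
have e1 j w : 1 <= e j w.
  by rewrite eE -expR0 ler_expR sqr_ge0.
have bound w j : `|noise_form eps (y j) w| + c / k * (l%:R * 2) <=
    c * a + c / k * \sum_i e i w.
  (* The other l - 1 terms are at least 1 each; keeping them gives 1 + l under the logarithm instead
     of 2 l. *)
  have sum_e : e j w + (l%:R - 1) <= \sum_i e i w.
    rewrite (bigD1 j)//= lerD2l.
    apply: (@le_trans _ _ (\sum_(i | i != j) 1)).
      by rewrite sumr_const cardC1 card_ord -[in leLHS](prednK l0) -natr1 addrK.
    by apply: ler_sum => i _; exact: e1.
  have := tangent a (`|noise_form eps (y j) w| / c).
  rewrite -eE ea -/k => tgt.
  have {}tgt : k * (`|noise_form eps (y j) w| / c) + l%:R * 2 <=
    k * a + \sum_i e i w by lra.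
  have ck : 0 < c / k by rewrite divr_gt0.
  rewrite -(ler_pM2l ck) in tgt.
  apply: le_trans (le_trans tgt _); rewrite le_eqVlt; apply/orP; left; apply/eqP.
    by field; rewrite !gt_eqF.
  by field; rewrite !gt_eqF.
have max_bound w : noise_max y w + c / k * (l%:R * 2) <=
    c * a + c / k * \sum_i e i w.
  rewrite -lerBrDr; apply: bigmax_le => [|j _]; last by rewrite lerBrDr bound.
  (* The starting value 0 of the maximum is handled by the first form, which exists because l >
     0. *)
  have := bound w (Ordinal l0); rewrite -lerBrDr; exact: le_trans.
have me j : measurable_fun setT (e j).
  apply: measurableT_comp => //; apply: measurable_funM => //.
  apply: measurable_funX; apply: measurable_funM => //.
  exact: measurable_noise_form.
have ck0 : 0 <= c / k by rewrite divr_ge0 ?ltW.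
have mm := measurable_noise_max y.
(* The constant stays on the left so that every integrand is nonnegative; it cancels at the end
   against the mean 2 l of the sum. *)
have : (\int[P]_w ((noise_max y w)%:E + (c / k * (l%:R * 2))%:E) <=
    \int[P]_w ((c * a)%:E + (c / k)%:E * \sum_i (e i w)%:E))%E.
  apply: ge0_le_integral => //.
  - move=> w _; rewrite -EFinD lee_fin addr_ge0 ?noise_max_ge0//.
    by rewrite mulr_ge0// mulr_ge0.
  - by apply: emeasurable_funD => //; exact/measurable_EFinP.
  - apply: emeasurable_funD => //; apply: measurable_funeM.
    by apply: emeasurable_sum => j; exact/measurable_EFinP.
  - by move=> w _; rewrite sumEFin -EFinM -!EFinD lee_fin.
rewrite ge0_integralD//; last 3 first.
- by move=> w _; rewrite lee_fin noise_max_ge0.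
- exact/measurable_EFinP.
- by move=> w _; rewrite lee_fin mulr_ge0// mulr_ge0.
have sum_ge0 w : (0 <= \sum_i (e i w)%:E)%E.
  by apply: sume_ge0 => i _; rewrite lee_fin expR_ge0.
have msum : measurable_fun setT (fun w => \sum_i (e i w)%:E)%E.
  by apply: emeasurable_sum => j; exact/measurable_EFinP.
rewrite ge0_integralD//; last 3 first.
- by move=> w _; rewrite lee_fin mulr_ge0 ?ltW.
- by move=> w _; rewrite mule_ge0.
- exact: measurable_funeM.
rewrite ge0_integralZl_EFin// ge0_integral_sum//; last 2 first.
- by move=> j; exact/measurable_EFinP.
- by move=> j w _; rewrite lee_fin expR_ge0.
rewrite (eq_bigr (fun=> 2%:E)); last first.
  move=> j _; rewrite /e -(yr j); apply: noise_form_exp_sqr => //.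
  by rewrite yr gt_eqF.
rewrite sumEFin sumr_const card_ord -(mulr_natl 2 l) -EFinM.
rewrite !integral_cst//= probability_setT !mule1 leeD2rE//.
by rewrite sqrtrM ?divr_ge0// mulrA.
Qed.

End noise_max.

(** Lets a bound valid for every x pass to the correlation factor. The left side is extended real
    because it will be an integral not yet known to be finite. *)
Lemma le_mul_inf (R : realType) (S : set R) (c : R) (e : \bar R) : 0 <= c ->
  S !=set0 -> (forall s, S s -> (e <= (c * s)%:E)%E) -> (e <= (c * inf S)%:E)%E.
Proof.
rewrite le_eqVlt => /predU1P[<-|c0] [s0 Ss0] eS.
  by have := eS _ Ss0; rewrite !mul0r.
case: e eS => [r| |] eS.
- rewrite lee_fin -ler_pdivrMl//; apply: lb_le_inf; first by exists s0.
  by move=> s /eS; rewrite lee_fin ler_pdivrMl.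
- by have := eS _ Ss0; rewrite leNgt ltry.
- by rewrite leNye.
Qed.

(** * From the suprema over beta to the columns, and from the columns to the correlation factors *)

Section correlation.
Context (R : realType) d (T : measurableType d) (P : probability T R) (n p : nat).
Variable eps : 'I_n -> {RV P >-> R}.
Hypothesis eps_normal : standard_normal_vector eps.
Hypotheses (n_gt0 : (0 < n)%N) (p_gt0 : (0 < p)%N).
Variable X : 'M[R]_(n, p).
Hypothesis X_normalized : forall j, (X^T *m X) j j = n%:R.

Local Notation noise_sup := (noise_max eps (fun m : 'I_p => col m X)).

Lemma le_noise_max l (y : 'I_l -> 'cV[R]_n) j w :
  `|noise_form eps (y j) w| <= noise_max eps y w.
Proof. exact: le_bigmax. Qed.

Lemma noise_form_sum_le l (y : 'I_l -> 'cV[R]_n) (c : 'I_l -> R) w :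
  `|noise_form eps (\sum_j c j *: y j) w| <= (\sum_j `|c j|) * noise_max eps y w.
Proof.
have -> : noise_form eps (\sum_j c j *: y j) w =
    \sum_j c j * noise_form eps (y j) w.
  rewrite /noise_form mulmx_sumr summxE; apply: eq_bigr => j _.
  by rewrite -scalemxAr mxE.
apply: (le_trans (ler_norm_sum _ _ _)); rewrite mulr_suml.
by apply: ler_sum => j _; rewrite normrM ler_wpM2l// le_noise_max.
Qed.

Lemma mulmx_sum_col (b : 'cV[R]_p) : X *m b = \sum_m b m ord0 *: col m X.
Proof.
apply/matrixP => i j; rewrite mxE summxE; apply: eq_bigr => m _.
by rewrite !mxE mulrC (ord1 j).
Qed.

Lemma noise_form_mulmx_le (b : 'cV[R]_p) w :
  `|noise_form eps (X *m b) w| <= l1norm b * noise_sup w.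
Proof. by rewrite mulmx_sum_col noise_form_sum_le. Qed.

Lemma noise_formZ c v w : noise_form eps (c *: v) w = c * noise_form eps v w.
Proof. by rewrite /noise_form -scalemxAr mxE. Qed.

Lemma noise_formM (b : 'cV[R]_p) w :
  ((noise_vector eps w)^T *m X *m b) ord0 ord0 = noise_form eps (X *m b) w.
Proof. by rewrite /noise_form mulmxA. Qed.

Lemma noise_form_delta m w :
  noise_form eps (X *m delta_mx m ord0) w = noise_form eps (col m X) w.
Proof. by rewrite -colE. Qed.

Lemma l1norm_gt0 (b : 'cV[R]_p) : b != 0 -> 0 < l1norm b.
Proof.
move=> b0; rewrite lt_neqAle sumr_ge0// andbT eq_sym; apply: contra b0.
rewrite psumr_eq0// => /allP b0; apply/eqP/matrixP => i j.
have := b0 i (mem_index_enum i); rewrite /= normr_eq0 (ord1 j) mxE.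
by move/eqP.
Qed.

Lemma l1norm_delta (c : R) m : l1norm (c *: (delta_mx m ord0 : 'cV[R]_p)) = `|c|.
Proof.
rewrite /l1norm (bigD1 m)//= !mxE !eqxx mulr1 big1 ?addr0// => i im.
by rewrite !mxE (negbTE im) mulr0 normr0.
Qed.

Lemma noise_sup_le l (y : 'I_l -> 'cV[R]_n) x w : 0 <= x ->
  (forall m : 'I_p, [set (1 + x) *: v | v in sconv y] (col m X)) ->
  noise_sup w <= (1 + x) * noise_max eps y w.
Proof.
move=> x0 Xy; have x1 : 0 <= 1 + x by rewrite addr_ge0.
apply: bigmax_le => [|m _]; first by rewrite mulr_ge0// noise_max_ge0.
have [_ [c [c1 ->]] <-] := Xy m.
rewrite noise_formZ normrM ger0_norm// ler_wpM2l//.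
apply: (le_trans (noise_form_sum_le _ _ _)).
by rewrite ler_piMl// noise_max_ge0.
Qed.

(** The l1 bound gives one direction and the basis vectors give the other. An exact equivalence
    turns the event of (1) into a sublevel set of a measurable function. *)
Lemma ereal_sup_ratioE (s lambda : R) w : 0 < s ->
  (ereal_sup [set (s * `|((noise_vector eps w)^T *m X *m b) ord0 ord0|
      / l1norm b)%:E | b in [set b : 'cV[R]_p | b != 0%R]] <= lambda%:E)%E =
  (s * noise_sup w <= lambda).
Proof.
move=> s0; apply/idP/idP => [sup_le|le_lambda].
  have col_le m : s * `|noise_form eps (col m X) w| <= lambda.
    rewrite -lee_fin; apply: le_trans sup_le; apply: ereal_sup_ubound.
    exists (delta_mx m ord0).
      apply/negP => /eqP/matrixP/(_ m ord0); rewrite !mxE !eqxx => /eqP.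
      by rewrite oner_eq0.
    rewrite noise_formM noise_form_delta.
    by rewrite -[delta_mx m ord0]scale1r l1norm_delta normr1 divr1.
  rewrite mulrC -ler_pdivlMr//; apply: bigmax_le => [|m _].
    (* The starting value 0 of the maximum requires [lambda] to be nonnegative, which any column
       yields since p > 0. *)
    apply: divr_ge0; last exact: ltW.
    by apply: le_trans (col_le (Ordinal p_gt0)); rewrite mulr_ge0// ltW.
  by rewrite ler_pdivlMr// mulrC.
apply: ge_ereal_sup => _ [b /= b0 <-]; rewrite noise_formM lee_fin.
have b1 := l1norm_gt0 b0.
rewrite ler_pdivrMr// mulrC; apply: le_trans (_ : l1norm b * noise_sup w * s <= _).
  by apply: ler_wpM2r; [exact: ltW|exact: noise_form_mulmx_le].
rewrite -mulrA mulrC; apply: ler_wpM2r; first exact: ltW.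
by rewrite mulrC.
Qed.

(** The supremum is attained at M times a basis vector. Equality makes the integrand of (2) a
    measurable real function. *)
Lemma ereal_sup_ballE (s M : R) w : 0 <= s -> 0 <= M ->
  ereal_sup [set (s * `|((noise_vector eps w)^T *m X *m b) ord0 ord0|)%:E
    | b in [set b : 'cV[R]_p | (l1norm b <= M)%R]] =
  (s * M * noise_sup w)%:E.
Proof.
move=> s0 M0; apply/eqP; rewrite eq_le; apply/andP; split.
  apply: ge_ereal_sup => _ [b /= bM <-]; rewrite noise_formM lee_fin -mulrA.
  rewrite ler_wpM2l//; apply: (le_trans (noise_form_mulmx_le _ _)).
  by rewrite ler_wpM2r// noise_max_ge0.
set S := ereal_sup _.
have SE m : ((`|noise_form eps (col m X) w| * (s * M))%:E <= S)%E.
  apply: ereal_sup_ubound; exists (M *: delta_mx m ord0) => /=.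
    by rewrite l1norm_delta ger0_norm.
  rewrite noise_formM -scalemxAr noise_formZ noise_form_delta normrM.
  by rewrite (ger0_norm M0) mulrA mulrC.
rewrite mulrC /noise_max.
apply: (big_ind (fun r : R => (r * (s * M))%:E <= S)%E).
- rewrite mul0r; apply: le_trans (SE (Ordinal p_gt0)).
  by rewrite lee_fin mulr_ge0// mulr_ge0.
- by move=> u v uS vS; rewrite maxEle; case: ifP.
- by move=> m _; exact: SE.
Qed.

Let corr_fun_cover x : 0 <= x -> (0 < corr_fun X x)%N /\
  exists y : 'I_(corr_fun X x) -> 'cV[R]_n,
    (forall j, l2norm (y j) = Num.sqrt n%:R) /\
    (forall w, noise_sup w <= (1 + x) * noise_max eps y w).
Proof.
move=> x0; have [[l0 [y [yn Xy]]] _] := corr_funP p_gt0 X_normalized x0.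
by split => //; exists y; split => // w; exact: noise_sup_le.
Qed.

Lemma measurable_noise_sup : measurable_fun setT noise_sup.
Proof. exact: measurable_noise_max. Qed.

Let sqrtn_gt0 : 0 < Num.sqrt n%:R :> R. Proof. by rewrite sqrtr_gt0 ltr0n. Qed.

(** The square root is the level u at which the union bound 2 K(x) exp(- u^2 / (2 n)) equals [kappa]
    exactly. *)
Let noise_sup_tail x kappa t : 0 <= x -> 0 < kappa <= 1 ->
  (1 + x) * Num.sqrt (2 * n%:R * ln (2 * (corr_fun X x)%:R / kappa)) <= t ->
  ((1 - kappa)%:E <= P [set w | (noise_sup w <= t)%R])%E.
Proof.
move=> x0 /andP[k0 k1]; have [l0 [y [yn yX]]] := corr_fun_cover x0.
set l := corr_fun X x in l0 y yn yX *; set u := Num.sqrt _ => ut.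
have x1 : 0 < 1 + x by rewrite ltr_pwDl.
have lR : 1 <= l%:R :> R by rewrite ler1n.
have lk1 : 1 < 2 * l%:R / kappa by rewrite ltr_pdivlMr//; lra.
have u2 : u ^+ 2 = 2 * n%:R * ln (2 * l%:R / kappa).
  by rewrite sqr_sqrtr// mulr_ge0 ?mulr_ge0// ltW// ln_gt0.
have u0 : 0 < u by rewrite sqrtr_gt0 mulr_gt0 ?ln_gt0// mulr_gt0 ?ltr0n.
have mU : measurable [set w | u < noise_max eps y w].
  rewrite -[X in measurable X]setTI.
  have := measurable_noise_max eps y measurableT (measurable_itv `]u, +oo[).
  by congr measurable; apply/seteqP; split => w /=; rewrite in_itv/= andbT.
have mS : measurable [set w | noise_sup w <= t].
  rewrite -[X in measurable X]setTI.
  have := measurable_noise_sup measurableT (measurable_itv `]-oo, t]).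
  by congr measurable; apply/seteqP; split => w /=; rewrite in_itv.
apply: (@le_trans _ _ (P (~` [set w | u < noise_max eps y w]))); last first.
  apply: le_measure; rewrite ?inE//; first exact: measurableC.
  move=> w /= /negP; rewrite -leNgt => wu.
  by apply: (le_trans (yX w)); apply: le_trans ut; rewrite ler_wpM2l// ltW.
rewrite probability_setC// EFinB leeB//.
have := noise_max_tail eps_normal u0 (lt0r_neq0 sqrtn_gt0) yn.
rewrite u2 sqr_sqrtr ?ler0n//.
have -> : 2 * n%:R * ln (2 * l%:R / kappa) / (2 * n%:R) =
    ln (2 * l%:R / kappa) :> R.
  by field; rewrite pnatr_eq0 -lt0n.
rewrite expRN lnK ?posrE ?(lt_trans ltr01)//.
have -> // : l%:R * (2 * (2 * l%:R / kappa)^-1) = kappa :> R.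
by field; rewrite !gt_eqF// (lt_le_trans ltr01).
Qed.

Lemma noise_sup_prob kappa t : 0 < kappa <= 1 ->
  corr_factor_kappa X kappa * Num.sqrt (2 * n%:R * ln (2 * p%:R / kappa)) <= t ->
  ((1 - kappa)%:E <= P [set w | (noise_sup w <= t)%R])%E.
Proof.
move=> k01 Ht; have /andP[k0 k1] := k01.
pose Z : {RV P >-> R} :=
  HB.pack noise_sup (isMeasurableFun.Build _ _ _ _ _ measurable_noise_sup).
have pR : 1 <= p%:R :> R by rewrite ler1n.
have pk1 : 1 < 2 * p%:R / kappa by rewrite ltr_pdivlMr//; lra.
set L := Num.sqrt _ in Ht.
have L0 : 0 < L by rewrite sqrtr_gt0 mulr_gt0 ?ln_gt0// mulr_gt0 ?ltr0n.
have cdfE r : cdf Z r = P [set w | noise_sup w <= r].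
  by rewrite /cdf /distribution /pushforward/=; congr (P _);
    apply/seteqP; split => w /=; rewrite in_itv.
(* It suffices to treat r > t: then r / L exceeds the infimum strictly, so some x realizes a value
   below it. *)
rewrite -cdfE; apply: cvge_ge (@cdf_right_continuous _ _ _ P Z t).
near=> r; have tr : t < r by near: r; exact: nbhs_right_gt.
rewrite cdfE.
have /inf_lt [] : corr_factor_kappa X kappa < r / L.
- by rewrite ltr_pdivlMr// (le_lt_trans Ht).
- by eexists; exists 0; first by rewrite /= in_itv/= lexx.
move=> _ [x x_in <-]; move: x_in.
rewrite /= in_itv/= andbT ltr_pdivlMr// => x0 xr.
apply: (noise_sup_tail x0) => //; apply: le_trans (ltW xr).
(* The denominator ln(2 p / kappa) of the correlation factor cancels against the same logarithm in
   [L], leaving the threshold of [noise_sup_tail]. *)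
rewrite -[leRHS]mulrA; apply: ler_wpM2l; first exact: addr_ge0.
rewrite /L -sqrtrM.
  rewrite le_eqVlt; apply/orP; left; apply/eqP; congr Num.sqrt.
  by field; rewrite !gt_eqF ?ln_gt0.
have [l0 _] := corr_fun_cover x0.
apply: divr_ge0; apply: ltW; apply: ln_gt0 => //; rewrite ltr_pdivlMr//.
have : 1 <= (corr_fun X x)%:R :> R by rewrite ler1n.
lra.
Unshelve. all: by end_near. Qed.

Lemma noise_sup_expectation :
  (\int[P]_w (noise_sup w)%:E <=
   (Num.sqrt (8 * n%:R * ln (1 + p%:R) / 3) * corr_factor X)%:E)%E.
Proof.
have lnp : 0 < ln (1 + p%:R) :> R by rewrite ln_gt0// ltrDl ltr0n.
apply: le_mul_inf => //.
  by eexists; exists 0; first by rewrite /= in_itv/= lexx.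
move=> _ [x x_in <-]; move: x_in; rewrite /= in_itv/= andbT => x0.
have [l0 [y [yn yX]]] := corr_fun_cover x0.
have x1 : 0 <= 1 + x by rewrite addr_ge0.
have lnl : 0 < ln (1 + (corr_fun X x)%:R) :> R by rewrite ln_gt0// ltrDl ltr0n.
apply: (@le_trans _ _ (\int[P]_w ((1 + x)%:E * (noise_max eps y w)%:E))%E).
  apply: ge0_le_integral => //.
  - by move=> w _; rewrite lee_fin noise_max_ge0.
  - apply/measurable_EFinP; exact: measurable_noise_sup.
  - apply: measurable_funeM; apply/measurable_EFinP.
    exact: measurable_noise_max.
  - by move=> w _; rewrite -EFinM lee_fin.
rewrite ge0_integralZl_EFin//; last 2 first.
- by move=> w _; rewrite lee_fin noise_max_ge0.
- apply/measurable_EFinP; exact: measurable_noise_max.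
apply: (@le_trans _ _ ((1 + x)%:E * (Num.sqrt n%:R *
    Num.sqrt (8 / 3 * ln (1 + (corr_fun X x)%:R)))%:E)%E).
  rewrite lee_wpmul2l ?lee_fin//.
  exact: (noise_max_expectation eps_normal l0 sqrtn_gt0).
(* Here too ln(1 + p) cancels, and both sides are the square root of 8/3 n ln(1 + K(x)). *)
rewrite -EFinM lee_fin [leRHS]mulrCA; apply: ler_wpM2l => //.
rewrite -!sqrtrM ?ler0n//; last first.
  by rewrite divr_ge0// mulr_ge0 ?ltW// mulr_gt0// ltr0n.
rewrite le_eqVlt; apply/orP; left; apply/eqP; congr Num.sqrt.
by field; rewrite gt_eqF.
Qed.

End correlation.

(** * The probability and expectation bounds for the suprema over beta *)

Theorem theorem3p2 (R : realType) (d : measure_display) (T : measurableType d)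
    (P : probability T R) (n p : nat) (n_gt0 : (0 < n)%N) (p_gt0 : (0 < p)%N)
    (X : 'M[R]_(n, p)) (X_normalized : forall j, (X^T *m X) j j = n%:R)
    (sigma : R) (sigma_gt0 : 0 < sigma)
    (eps : 'I_n -> {RV P >-> R}) (eps_normal : standard_normal_vector eps) :
  (forall kappa lambda : R, 0 < kappa <= 1 ->
     corr_factor_kappa X kappa * 2 * sigma
       * Num.sqrt (2 * n%:R * ln (2 * p%:R / kappa)) <= lambda ->
     ((1 - kappa)%:E <=
      P [set w | ereal_sup
           [set (2 * sigma
                 * `|((noise_vector eps w)^T *m X *m b) ord0 ord0|
                 / l1norm b)%:E | b in [set b : 'cV[R]_p | b != 0%R]]
           <= lambda%:E])%E) /\
  (forall M : R, 0 <= M ->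
     (\int[P]_w ereal_sup
           [set (sigma * `|((noise_vector eps w)^T *m X *m b) ord0 ord0|)%:E
           | b in [set b : 'cV[R]_p | (l1norm b <= M)%R]]
      <= (corr_factor X * sigma
          * Num.sqrt (8 * n%:R * ln (1 + p%:R) / 3) * M)%:E)%E).
Proof.
split=> [kappa lambda kappa01|M M0].
  set L := Num.sqrt _ => lambda_ge.
  have s0 : 0 < 2 * sigma by rewrite mulr_gt0.
  under eq_set do rewrite ereal_sup_ratioE//.
  rewrite (_ : [set w | _] = [set w |
      noise_max eps (fun m => col m X) w <= lambda / (2 * sigma)]); last first.
    by apply/seteqP; split => w /=; rewrite ler_pdivlMr// mulrC.
  (* Dividing by 2 sigma turns the lower bound on [lambda] into the threshold K_kappa times [L] for
     the column maximum. *)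
  apply: noise_sup_prob => //; rewrite ler_pdivlMr// -/L.
  by apply: le_trans lambda_ge; rewrite mulrAC -!mulrA.
under eq_integral do rewrite ereal_sup_ballE ?(ltW sigma_gt0)//.
have sM : 0 <= sigma * M by rewrite mulr_ge0// ltW.
under eq_integral do rewrite EFinM.
rewrite ge0_integralZl_EFin//; last 2 first.
- by move=> w _; rewrite lee_fin noise_max_ge0.
- by apply/measurable_EFinP; exact: measurable_noise_max.
set L := Num.sqrt _.
have -> : corr_factor X * sigma * L * M = sigma * M * (L * corr_factor X) by ring.
rewrite [leRHS]EFinM; apply: lee_wpmul2l; first by rewrite lee_fin.
exact: noise_sup_expectation.
Qed.
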